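(* Let $f=q/p$ (in lowest terms) be a nonconstant rational Schur function on $\mathbb{H}^2$ with a singularity at $(0,0)$ (i.e. $p(0,0)=0$) and non-tangential value $f^*(0,0)$. If a sequence $(x^n)\subset\mathbb{R}^2$ (of points at which $f$ is defined, i.e. $p(x^n)\ne0$) satisfies $$x^n\to(0,0)\quad\text{and}\quad f(x^n)\to\zeta_0\ne f^*(0,0)$$ for some $\zeta_0 \in \mathbb{C}$, then there is a finite number of horns $\mathscr{H}_1,\dots,\mathscr{H}_L$ in $\mathbb{R}^2$ at $(0,0)$ such that for $n$ sufficiently large, $x^n\in\bigcup_{\ell=1}^L\mathscr{H}_\ell$. Moreover, the number $L$ and the slopes of the horns do not depend on the sequence $(x^n)$ (they can be chosen depending only on $f$).
   Context: $\mathbb{H}$ is the open upper half plane. A rational Schur function on $\mathbb{H}^2$ is a rational function analytic on $\mathbb{H}^2$ with $|f|\le1$ there. $f^*(0,0)$ is the non-tangential limit of $f$ at $(0,0)$: the common limit of $f(z)$ as $z\to(0,0)$ within each region $\{z\in\mathbb{H}^2:1/c\le a/b\le c\text{ for all }a,b\in\{|z_1|,|z_2|,\operatorname{Im}z_1,\operatorname{Im}z_2\}\}$, $c\ge1$; it is known to exist. A non-trivial horn at $(0,0)$ with slope $a\ne0$ is a region of points $(x_1,x_2)\in\mathbb{R}^2$ sufficiently close to $(0,0)$ such that $|x_2-ax_1|\le Bx_1^2$, for some fixed $B>0$. A trivial horn at $(0,0)$ is either oriented along the $x_2$-axis, consisting of $(x_1,x_2)\in\mathbb{R}^2$ with $|x_1|\le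 Bx_2^2$ for some fixed $B>0$ (slope $\infty$), or oriented along the $x_1$-axis, consisting of $(x_1,x_2)\in\mathbb{R}^2$ with $|x_2|\le Bx_1^2$ for some fixed $B>0$ (slope $0$). A horn is a trivial or non-trivial horn. *)

(* Defs.v *)
From HB Require Import structures.
From mathcomp Require Import all_boot all_order all_algebra.
From mathcomp Require Import complex polyXY.
From mathcomp Require Import all_classical all_reals all_analysis.
Set Implicit Arguments.
Unset Strict Implicit.
Unset Printing Implicit Defensive.
Import Order.TTheory GRing.Theory Num.Theory.
Import numFieldNormedType.Exports.
Local Open Scope classical_set_scope.
Local Open Scope complex_scope.
Local Open Scope ring_scope.

(* The usual topology on R[i]: that of a numFieldType as a normed module over
   itself, as R[i]^o already carries it. It makes differentiability of maps
   between R[i] * R[i] and R[i] mean complex differentiability. *)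
HB.instance Definition _ (R : realType) := NormedModule.copy R[i] R[i]^o.

Definition bi_half_plane (R : realType) : set (R[i] * R[i]) :=
  [set z | 0 < complex.Im z.1 /\ 0 < complex.Im z.2].

(* {poly {poly R[i]}} stands for C[z1, z2]: the outer variable 'X is z1 and
   the coefficients are polynomials in z2. *)
Definition eval2 (R : realType) (p : {poly {poly R[i]}}) (z : R[i] * R[i]) :
  R[i] := p.[z.1, z.2].

Definition ratfun (R : realType) (q p : {poly {poly R[i]}})
  (z : R[i] * R[i]) : R[i] := eval2 q z / eval2 p z.

(* Stated with genuine factorizations, because %| of polydiv is
   pseudo-divisibility when the coefficients are only a domain. *)
Definition lowest_terms (R : realType) (q p : {poly {poly R[i]}}) : Prop :=
  forall d a b : {poly {poly R[i]}},
    q = d * a -> p = d * b -> d \is a GRing.unit.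

(* The domain of q / p in lowest terms is the set where p does not vanish;
   outside it ratfun takes the junk value 0. *)
Definition rational_schur (R : realType) (q p : {poly {poly R[i]}}) : Prop :=
  forall z : R[i] * R[i], bi_half_plane z ->
    [/\ eval2 p z != 0, differentiable (ratfun q p) z &
        `|ratfun q p z| <= 1].

Definition nonconstant (R : realType) (q p : {poly {poly R[i]}}) : Prop :=
  ~ exists c : R[i], forall z, eval2 p z != 0 -> ratfun q p z = c.

Definition nt_region (R : realType) (c : R) : set (R[i] * R[i]) :=
  [set z | bi_half_plane z /\
    {in [:: Normc.normc z.1; Normc.normc z.2; complex.Im z.1; complex.Im z.2] &,
      forall a b : R, c^-1 <= a / b <= c}].

Definition nt_limit0 (R : realType) (f : R[i] * R[i] -> R[i]) (l : R[i]) :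
  Prop :=
  forall c : R, 1 <= c ->
    f z @[z --> within (nt_region c) (nbhs (0 : R[i] * R[i]))] --> l.

(* Slopes live in R together with infinity, which is None. *)
Definition horn (R : realType) (s : option R) (B delta : R) : set (R * R) :=
  [set x | `|x| < delta /\
    match s with
    | Some a => `|x.2 - a * x.1| <= B * x.1 ^+ 2
    | None => `|x.1| <= B * x.2 ^+ 2
    end].

Definition is_horn (R : realType) (s : option R) (H : set (R * R)) : Prop :=
  exists B delta : R, [/\ 0 < B, 0 < delta & H = horn s B delta].

Definition real_pt (R : realType) (x : R * R) : R[i] * R[i] :=
  (x.1%:C, x.2%:C).

(* Main.v *)
(** Put g = q - f^* p and let M be the order of vanishing of p at the origin.
    The non-tangential limit forces g to vanish to order at least M + 1, so
    g / p tends to 0 away from the real lines on which the lowest homogeneous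
    part P of p vanishes.  Near such a line write z2 = s z1 + v and let m be the
    multiplicity of the factor v in P.  If v had size y^rho with
    1 < rho < 2 on some branch of p(y, s y + v) = 0, the corresponding edge of
    the Newton polygon would define, for y = 1 and y = -1, limits of stable
    polynomials in v whose next-to-leading coefficient vanishes, so all zeros
    of both would be real; but for rho = a / b the zeros for y = -1 are those
    for y = 1 multiplied by exp(i pi a / b), which is not real.  Hence every
    monomial y^i v^j of p satisfies i + 2 j >= M + m, and |g| <= C |p| on R^2
    transfers this to g.
    As soon as |v| >= B y^2 with B large, y^(M-m) v^m dominates all other
    monomials of p and all monomials of g, so g / p is small. *)
Require Import Defs.
From mathcomp Require Import all_boot all_order all_algebra.
From mathcomp Require Import complex polyXY ring lra zify.
From mathcomp Require Import all_classical all_reals all_analysis.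
Set Implicit Arguments.
Unset Strict Implicit.
Unset Printing Implicit Defensive.
Import Order.TTheory GRing.Theory Num.Theory.
Import numFieldNormedType.Exports.
Local Open Scope classical_set_scope.
Local Open Scope complex_scope.
Local Open Scope ring_scope.

Local Notation normc := Normc.normc.
Local Notation Re := complex.Re.
Local Notation Im := complex.Im.
(** A finite box containing every exponent pair of [p]; sums over it may include zero
    coefficients. *)
Local Notation idx p := ('I_(size p) * 'I_(sizeY p))%type.

(** * The real-valued modulus on [R[i]] *)

Section ComplexModulus.
Variable R : realType.
Implicit Types (x y : R[i]) (a t : R).

Lemma normc_ge0 x : 0 <= normc x.
Proof. by case: x => a b; apply: sqrtr_ge0. Qed.

Lemma normcD x y : normc (x + y) <= normc x + normc y.
Proof. exact: le_normcD. Qed.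

Lemma normcB x y : normc (x - y) <= normc x + normc y.
Proof. by rewrite (le_trans (normcD _ _)) // [normc (- y)]normcN. Qed.

Lemma normc_eq0 x : (normc x == 0) = (x == 0).
Proof.
by apply/eqP/eqP => [/Normc.eq0_normc //|->]; rewrite Normc.normc0.
Qed.

Lemma normc_gt0 x : (0 < normc x) = (x != 0).
Proof. by rewrite lt0r normc_eq0 normc_ge0 andbT. Qed.

Lemma normcX x n : normc (x ^+ n) = normc x ^+ n.
Proof.
by elim: n => [|n IH]; rewrite ?expr0 ?Normc.normc1 // !exprS Normc.normcM IH.
Qed.

Lemma normcR a : normc a%:C = `|a|.
Proof. by rewrite /= expr0n addr0 sqrtr_sqr. Qed.

Lemma normci : normc ('i%C : R[i]) = 1.
Proof. by rewrite /= expr0n expr1n add0r sqrtr1. Qed.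

Lemma normr_normc x : `|x| = (normc x)%:C.
Proof. by rewrite normc_def; case: x. Qed.

Lemma normc_sum (I : Type) (s : seq I) (P : pred I) (F : I -> R[i]) :
  normc (\sum_(i <- s | P i) F i) <= \sum_(i <- s | P i) normc (F i).
Proof.
elim/big_rec2: _ => [|i y1 y2 _ IH]; first by rewrite Normc.normc0.
by rewrite (le_trans (normcD _ _)) // lerD2l.
Qed.

Lemma normc_prod (I : Type) (s : seq I) (F : I -> R[i]) :
  normc (\prod_(i <- s) F i) = \prod_(i <- s) normc (F i).
Proof.
by elim/big_rec2: _ => [|i y1 y2 _ <-]; rewrite ?Normc.normc1 ?Normc.normcM.
Qed.

Lemma normc_ge_absRe x : `|Re x| <= normc x.
Proof.
case: x => a b /=; rewrite -(sqrtr_sqr a) ler_wsqrtr // lerDl sqr_ge0 //.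
Qed.

Lemma normc_ge_absIm x : `|Im x| <= normc x.
Proof.
case: x => a b /=; rewrite -(sqrtr_sqr b) ler_wsqrtr // lerDr sqr_ge0 //.
Qed.

Lemma ReB x y : Re (x - y) = Re x - Re y. Proof. by case: x y => ? ? []. Qed.
Lemma ImB x y : Im (x - y) = Im x - Im y. Proof. by case: x y => ? ? []. Qed.

Lemma ImZ a x : Im (a%:C * x) = a * Im x.
Proof. by case: x => b c /=; ring. Qed.

Lemma Im_sum (I : Type) (s : seq I) (F : I -> R[i]) :
  Im (\sum_(i <- s) F i) = \sum_(i <- s) Im (F i).
Proof.
by elim/big_rec2: _ => // i y1 y2 _ <-; case: (F i) y2 => ? ? [].
Qed.

End ComplexModulus.

(** * One-variable polynomials near 0 *)

Section OneVariable.
Variable R : realType.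
Local Notation C := R[i].
Implicit Types (p h : {poly C}) (z v : C) (t : R).

Lemma poly_bounded h :
  exists2 K : R, 0 < K & forall z, normc z <= 1 -> normc h.[z] <= K.
Proof.
elim/poly_ind: h => [|h c [K K0 hK]].
  by exists 1 => // z _; rewrite horner0 Normc.normc0.
exists (K + normc c); first by rewrite ltr_wpDr ?normc_ge0.
move=> z z1; rewrite hornerMXaddC (le_trans (normcD _ _)) // lerD2r.
rewrite Normc.normcM -[leRHS]mulr1 ler_pM ?normc_ge0 ?hK //.
Qed.

Lemma poly_lipschitz0 h :
  exists2 K : R, 0 < K &
    forall z, normc z <= 1 -> normc (h.[z] - h.[0]) <= K * normc z.
Proof.
elim/poly_ind: h => [|h c _].
  by exists 1 => // z _; rewrite !horner0 subr0 Normc.normc0 mul1r normc_ge0.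
have [K K0 hK] := poly_bounded h; exists K => // z z1.
rewrite !hornerMXaddC mulr0 add0r addrK Normc.normcM ler_wpM2r ?normc_ge0 //.
exact: hK.
Qed.

(** Polynomials are Lipschitz at 0, so the inequality at a small real point d passes to 0 up to an
    error proportional to d. *)
Lemma poly_le_at0 h1 h2 (K : R) : 0 <= K ->
  (forall e : R, 0 < e <= 1 -> normc h1.[e%:C] <= K * normc h2.[e%:C]) ->
  normc h1.[0] <= K * normc h2.[0].
Proof.
move=> K0 h12.
have [K1 K10 hK1] := poly_lipschitz0 h1.
have [K2 K20 hK2] := poly_lipschitz0 h2.
apply/ler_addgt0Pr => e e0.
pose d := Num.min 1 (e / (K1 + K * K2)).
have S0 : 0 < K1 + K * K2 by rewrite ltr_wpDr // mulr_ge0 // ltW.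
have d0 : 0 < d by rewrite lt_min ltr01 divr_gt0.
have d1 : d <= 1 by rewrite ge_min lexx.
have dn : normc d%:C = d by rewrite normcR gtr0_norm.
have de : d * (K1 + K * K2) <= e.
  by rewrite -ler_pdivlMr // ge_min lexx orbT.
have := h12 d; rewrite d0 d1 => /(_ isT) H.
have := hK1 d%:C; have := hK2 d%:C; rewrite dn => /(_ d1) H2 /(_ d1) H1.
have A1 : normc h1.[0] <= normc h1.[d%:C] + K1 * d.
  rewrite -[h1.[0]](subKr h1.[d%:C]) (le_trans (normcB _ _)) // lerD2l //.
have A2 : normc h2.[d%:C] <= normc h2.[0] + K2 * d.
  rewrite -[h2.[d%:C]](subrK h2.[0]) addrC (le_trans (normcD _ _)) // lerD2l //.
have := ler_wpM2l K0 A2; nra.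
Qed.

Lemma poly_eq0_of_pos h : (forall t, 0 < t -> h.[t%:C] = 0) -> h = 0.
Proof.
move=> h0; apply: (@roots_geq_poly_eq0 _ h
  [seq (n.+1%:R : R)%:C | n <- iota 0 (size h)]).
- by apply/allP => _ /mapP[n _ ->]; apply/eqP/h0; rewrite ltr0Sn.
- rewrite map_inj_uniq ?iota_uniq // => m n /complexI/eqP.
  by rewrite eqr_nat eqSS => /eqP.
- by rewrite size_map size_iota.
Qed.

Lemma horner0_of_littleo h :
  (forall e : R, 0 < e -> exists2 s : R, 0 < s &
     forall t, 0 < t < s -> normc h.[t%:C] <= e) -> h.[0] = 0.
Proof.
move=> ho; have [K K0 hK] := poly_lipschitz0 h.
apply/eqP; rewrite -normc_eq0; apply/eqP/le_anti; rewrite normc_ge0 andbT.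
apply/ler_addgt0Pr => e e0; rewrite add0r.
have e2 : 0 < e / 2 by rewrite divr_gt0.
have [s s0 hs] := ho _ e2.
pose t := Num.min (Num.min 1 (s / 2)) (e / 2 / K).
have t0 : 0 < t by rewrite !lt_min ltr01 !divr_gt0.
have t1 : t <= 1 by rewrite !ge_min lexx.
have ts : t < s.
  rewrite (@le_lt_trans _ _ (s / 2)) //; last by lra.
  by rewrite !ge_min lexx orbT.
have te : K * t <= e / 2 by rewrite mulrC -ler_pdivlMr // ge_min lexx orbT.
have nt : normc t%:C = t by rewrite normcR gtr0_norm.
have := hs t; rewrite t0 ts => /(_ isT) H.
have := hK t%:C; rewrite nt => /(_ t1) H1.
rewrite -[h.[0]](subKr h.[t%:C]) (le_trans (normcB _ _)) //; lra.
Qed.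

(** Induction on [d]: the estimate kills the constant term, after which one factor t cancels on both
    sides. *)
Lemma coef0_of_littleo h (d : nat) :
  (forall e : R, 0 < e -> exists2 s : R, 0 < s &
     forall t, 0 < t < s -> normc h.[t%:C] <= e * t ^+ d) ->
  forall k, (k <= d)%N -> h`_k = 0.
Proof.
elim: d h => [|d IH] h ho; have h0 : h`_0 = 0.
- rewrite -horner_coef0; apply: horner0_of_littleo => e e0.
  by have [s s0 hs] := ho _ e0; exists s => // t /hs; rewrite expr0 mulr1.
- by move=> k; rewrite leqn0 => /eqP ->.
- rewrite -horner_coef0; apply: horner0_of_littleo => e e0.
  have [s s0 hs] := ho _ e0; exists (Num.min s 1).
    by rewrite lt_min s0 ltr01.
  move=> t; rewrite lt_min => /and3P[t0 ts /ltW t1].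
  rewrite (le_trans (hs t _)) ?t0 // -[leRHS]mulr1 ler_wpM2l ?(ltW e0) //.
  by rewrite exprn_ile1 // ltW.
elim/poly_ind: h ho h0 => [|h c _] ho; first by move=> _ k _; rewrite coef0.
rewrite coefD coefMX coefC eqxx add0r => c0.
rewrite c0 addr0 in ho *.
case=> [|k] kd; rewrite coefMX //=.
apply: IH kd => e e0; have [s s0 hs] := ho _ e0; exists s => // t ts.
have /andP[t0 _] := ts; have := hs t ts.
rewrite hornerMX Normc.normcM normcR gtr0_norm // exprSr mulrA.
by rewrite ler_pM2r.
Qed.

End OneVariable.

(** * Stable polynomials and their limits *)

Section Stability.
Variable R : realType.
Local Notation C := R[i].
Implicit Types (p : {poly C}) (z v : C).

Definition stable_or_zero p := forall v, 0 < Im v -> p.[v] = 0 -> p = 0.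

Lemma poly_eq0 p : (forall v, p.[v] = 0) -> p = 0.
Proof. by move=> p0; apply: poly_eq0_of_pos => t _. Qed.

(** Every root r lies in the closed lower half-plane, so |v0 - r| >= Im v0 and |v - r| <= (1 + |v -
    v0| / Im v0) |v0 - r|; multiply over the roots, at most [n] in number. *)
Lemma stable_growth p (n : nat) v0 v : stable_or_zero p -> (size p <= n.+1)%N ->
  0 < Im v0 ->
  normc p.[v] <= (1 + normc (v - v0) / Im v0) ^+ n * normc p.[v0].
Proof.
move=> ps sn v00.
have [->|p0] := eqVneq p 0; first by rewrite !horner0 Normc.normc0 mulr0.
have [rs prs] := closed_field_poly_normal p.
have lc0 : lead_coef p != 0 by rewrite lead_coef_eq0.
have srs : (size rs <= n)%N.
  by move: sn; rewrite prs size_scale // size_prod_XsubC.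
have rsI r : r \in rs -> Im r <= 0.
  move=> rrs; rewrite leNgt; apply/negP => r0.
  case/eqP: p0; apply: (ps r) => //; apply/rootP.
  by rewrite prs rootZ // root_prod_XsubC.
set K := 1 + _.
have K1 : 1 <= K by rewrite /K lerDl divr_ge0 ?normc_ge0 // ltW.
have evalE z :
    normc p.[z] = normc (lead_coef p) * \prod_(r <- rs) normc (z - r).
  rewrite [in LHS]prs hornerZ Normc.normcM horner_prod normc_prod.
  by congr (_ * _); apply: eq_bigr => r _; rewrite hornerXsubC.
rewrite !evalE mulrCA ler_wpM2l ?normc_ge0 //.
have Kpow : K ^+ size rs <= K ^+ n by rewrite ler_weXn2l.
apply: (@le_trans _ _ (K ^+ size rs * \prod_(r <- rs) normc (v0 - r))); last first.
  by rewrite ler_wpM2r // prodr_ge0 // => r _; rewrite normc_ge0.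
elim: rs rsI {prs srs evalE Kpow} => [|r rs IH] rsI.
  by rewrite !big_nil mulr1.
rewrite !big_cons exprS mulrACA ler_pM ?normc_ge0 ?prodr_ge0 //.
- by move=> i _; rewrite normc_ge0.
- have : Im v0 <= normc (v0 - r).
    rewrite (le_trans _ (normc_ge_absIm _)) // (le_trans _ (ler_norm _)) //.
    by rewrite ImB lerDl oppr_ge0 rsI ?mem_head.
  move=> v0r; rewrite mulrDl mul1r.
  have -> : v - r = (v0 - r) + (v - v0) by ring.
  rewrite (le_trans (normcD _ _)) // lerD2l -mulrA ler_peMr ?normc_ge0 //.
  by rewrite mulrC ler_pdivlMr // mul1r.
- by apply: IH => i irs; rewrite rsI // in_cons irs orbT.
Qed.

Lemma horner_swapC (F : {poly {poly C}}) z v :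
  F.[z%:P].[v] = (swapXY F).[v%:P].[z].
Proof. by rewrite horner2_swapXY. Qed.

(* Hurwitz: a zero of a limit of stable polynomials forces the limit to vanish,
   because a stable polynomial at any point is controlled by its value at one
   point of the half-plane. *)
Lemma stable_limit (F : {poly {poly C}}) :
  (forall e : R, 0 < e -> stable_or_zero F.[e%:C%:P]) ->
  stable_or_zero F.[0].
Proof.
move=> Fs v0 v00 F0; apply: poly_eq0 => v.
(* A degree bound common to all slices of [F], so that [K] does not depend on e. *)
pose n := sizeY F.
pose K := (1 + normc (v - v0) / Im v0) ^+ n.
have K0 : 0 <= K.
  by rewrite exprn_ge0 // addr_ge0 // divr_ge0 ?normc_ge0 // ltW.
(* Swapping the variables turns the value at v into a polynomial in the parameter e, which can then
   tend to 0. *)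
rewrite -[0]polyC0 horner_swapC; apply/eqP; rewrite -normc_eq0.
apply/eqP/le_anti; rewrite normc_ge0 andbT.
suff: normc (swapXY F).[v%:P].[0] <= K * normc (swapXY F).[v0%:P].[0].
  by rewrite -(horner_swapC F 0 v0) polyC0 F0 Normc.normc0 mulr0.
apply: poly_le_at0 => // e /andP[e0 _].
rewrite -!horner_swapC; apply: stable_growth (Fs _ e0) _ v00.
by rewrite (leq_trans (max_size_evalC _ _)).
Qed.

(** The next-to-leading coefficient is, up to a nonzero factor, the sum of the roots; their
    imaginary parts are nonpositive and add up to 0, so each is 0. *)
Lemma stable_real_roots p (m : nat) : stable_or_zero p -> size p = m.+2 ->
  p`_m = 0 -> forall v, p.[v] = 0 -> Im v = 0.
Proof.
move=> ps sp pm v pv.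
have p0 : p != 0 by rewrite -size_poly_eq0 sp.
have [rs prs] := closed_field_poly_normal p.
have lc0 : lead_coef p != 0 by rewrite lead_coef_eq0.
have srs : size rs = m.+1.
  by apply: succn_inj; rewrite -sp prs size_scale // size_prod_XsubC.
have rsI r : r \in rs -> Im r <= 0.
  move=> rrs; rewrite leNgt; apply/negP => r0.
  case/eqP: p0; apply: (ps r) => //; apply/rootP.
  by rewrite prs rootZ // root_prod_XsubC.
have vrs : v \in rs.
  by rewrite -root_prod_XsubC -(rootZ _ _ lc0) -prs; apply/rootP.
have := @coefPn_prod_XsubC _ rs; rewrite srs => /(_ isT) /= e.
move: pm; rewrite prs coefZ e => /eqP; rewrite mulf_eq0 (negPf lc0) /= oppr_eq0.
move=> /eqP sum0.
have /eqP : \sum_(r <- rs) - Im r = 0 by rewrite sumrN -Im_sum sum0 oppr0.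
rewrite big_seq psumr_eq0 => [/allP/(_ v vrs)|r /rsI]; last by rewrite oppr_ge0.
by rewrite vrs oppr_eq0 => /eqP.
Qed.

End Stability.

(** * Bivariate polynomials along weighted curves *)

Section Bivariate.
Variable R : realType.
Local Notation C := R[i].
Implicit Types (p g : {poly {poly C}}) (z v u w : C) (l t : R).

Lemma eval2E p x y :
  eval2 p (x, y) = \sum_(k : idx p) p`_k.1`_k.2 * (x ^+ k.1 * y ^+ k.2).
Proof.
rewrite -(pair_bigA _ 
  (fun (i : 'I_(size p)) (j : 'I_(sizeY p)) => p`_i`_j * (x ^+ i * y ^+ j))) /=.
rewrite /eval2 /= (horner_coef p) horner_sum; apply: eq_bigr => i _.
rewrite -rmorphXn hornerM hornerC.
rewrite (horner_coef_wide _ (max_size_coefXY p i)) mulr_suml.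
by apply: eq_bigr => j _; rewrite mulrAC mulrA.
Qed.

Lemma eval2Z_sub g p c (z : C * C) :
  eval2 (g - c%:P%:P * p) z = eval2 g z - c * eval2 p z.
Proof. by rewrite /eval2 !(hornerD, hornerN, hornerM, hornerC). Qed.

Lemma coef2_neq0 p i j : p`_i`_j != 0 -> (i < size p)%N /\ (j < sizeY p)%N.
Proof.
move=> pij; split; rewrite ltnNge; apply: contra pij => le.
  by rewrite (nth_default _ le) coef0.
by rewrite nth_default // (leq_trans (max_size_coefXY _ _)).
Qed.

Lemma sum_coef2 p i j :
  \sum_(k : idx p | (k.1 == i :> nat) && (k.2 == j :> nat)) p`_k.1`_k.2 =
  p`_i`_j.
Proof.
have [p0|/coef2_neq0[ip jp]] := eqVneq p`_i`_j 0.
  by rewrite p0 big1 // => k /andP[/eqP -> /eqP ->].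
by rewrite (big_pred1 (Ordinal ip, Ordinal jp)).
Qed.

Lemma weighted_monomial (x y w : C) (b i j : nat) :
  (x * y) ^+ i * (w * (x * y) ^+ b) ^+ j =
  (x ^+ (i + b * j) * w ^+ j) * y ^+ (i + b * j).
Proof.
rewrite !exprMn -!exprM !exprD.
move: (x ^+ i) (y ^+ i) (x ^+ (b * j)) (y ^+ (b * j)) (w ^+ j) => *; ring.
Qed.

(** Along the curve (u t, l (u t)^b) the polynomial becomes one in t, whose coefficient of t^e is
    u^e times a polynomial in l carrying the p_ij with i + b j = e. It vanishes for every positive
    l, hence identically. *)
Lemma weighted_littleo p u (b d : nat) : u != 0 ->
  (forall l, 0 < l -> forall e : R, 0 < e -> exists2 s : R, 0 < s &
     forall t, 0 < t < s ->
       normc (eval2 p (u * t%:C, l%:C * (u * t%:C) ^+ b)) <= e * t ^+ d) ->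
  forall i j, (i + b * j <= d)%N -> p`_i`_j = 0.
Proof.
move=> u0 po i j ijd.
pose e := (i + b * j)%N.
(* The coefficient of t^e along the curve, as a polynomial in l. *)
pose G := \sum_(k : idx p | (k.1 + b * k.2 == e)%N)
            (p`_k.1`_k.2 * u ^+ e) *: 'X^(k.2) : {poly C}.
have G0 : G = 0.
  apply: poly_eq0_of_pos => l l0.
  pose h := \sum_(k : idx p)
    (p`_k.1`_k.2 * l%:C ^+ k.2 * u ^+ (k.1 + b * k.2)) *: 'X^(k.1 + b * k.2) :
      {poly C}.
  have hE t : h.[t%:C] = eval2 p (u * t%:C, l%:C * (u * t%:C) ^+ b).
    rewrite eval2E horner_sum; apply: eq_bigr => k _.
    by rewrite hornerZ hornerXn weighted_monomial [u ^+ _ * _]mulrC !mulrA.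
  have := @coef0_of_littleo _ h d _ e ijd; rewrite coef_sum => <-.
    rewrite horner_sum big_mkcond; apply: eq_bigr => k _.
    rewrite coefZ coefXn [e == _]eq_sym.
    case: eqP => [->|_]; last by rewrite mulr0.
    by rewrite mulr1 hornerZ hornerXn mulrAC.
  move=> eps /(po l l0)[s s0 hs]; exists s => // t /hs; by rewrite hE.
have /eqP : G`_j = 0 by rewrite G0 coef0.
rewrite coef_sum (eq_bigr (fun k : idx p =>
  (k.2 == j :> nat)%:R * p`_k.1`_k.2 * u ^+ e)); last first.
  by move=> k _; rewrite coefZ coefXn [j == _]eq_sym mulrC mulrA.
rewrite -mulr_suml mulf_eq0 expf_eq0 (negPf u0) andbF orbF => /eqP S0.
apply: etrans S0; rewrite -[LHS]sum_coef2 big_mkcond [RHS]big_mkcond /=.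
apply: eq_bigr => k _.
have [kj|] := eqVneq (k.2 : nat) j; last by rewrite mul0r andbF; case: ifP.
by rewrite mul1r andbT kj /e eqn_add2r.
Qed.

Lemma weighted_bigO_eval p u w (b d : nat) :
  (forall i j, p`_i`_j != 0 -> (d <= i + b * j)%N) ->
  exists2 K : R, 0 < K & forall t, 0 < t <= 1 ->
    normc (eval2 p (u * t%:C, w * (u * t%:C) ^+ b)) <= K * t ^+ d.
Proof.
move=> pd.
pose a (k : idx p) := normc (p`_k.1`_k.2 * (u ^+ (k.1 + b * k.2) * w ^+ k.2)).
exists (1 + \sum_k a k).
  by rewrite ltr_pwDl // sumr_ge0 // => k _; apply: normc_ge0.
move=> t /andP[t0 t1]; have td0 : 0 <= t ^+ d by rewrite exprn_ge0 // ltW.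
apply: (@le_trans _ _ ((\sum_k a k) * t ^+ d)); last first.
  by rewrite ler_wpM2r // lerDr.
rewrite eval2E (le_trans (normc_sum _ _ _)) // mulr_suml ler_sum // => k _.
have [->|/pd dk] := eqVneq p`_k.1`_k.2 0.
  by rewrite mul0r Normc.normc0 mulr_ge0 ?normc_ge0.
rewrite weighted_monomial mulrA.
rewrite Normc.normcM ler_wpM2l ?normc_ge0 // normcX normcR gtr0_norm //.
by rewrite ler_wiXn2l // ltW.
Qed.

(** A bound O(t^d) is o(t^k) for every k < d. *)
Lemma weighted_bigO p u (b d : nat) : u != 0 ->
  (forall l, 0 < l -> exists2 K : R, 0 < K & forall t, 0 < t <= 1 ->
       normc (eval2 p (u * t%:C, l%:C * (u * t%:C) ^+ b)) <= K * t ^+ d) ->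
  forall i j, (i + b * j < d)%N -> p`_i`_j = 0.
Proof.
move=> u0 pO i j ijd; apply: (@weighted_littleo p u b (i + b * j)) => //.
move=> l l0 e e0.
have [K K0 hK] := pO l l0; exists (Num.min 1 (e / K)).
  by rewrite lt_min ltr01 divr_gt0.
move=> t; rewrite lt_min => /and3P[t0 /ltW t1 te].
rewrite (le_trans (hK t _)) ?t0 //.
(* The spare factor t, smaller than e / K, absorbs [K]. *)
have -> : d = (i + b * j + (d - (i + b * j).+1).+1)%N.
  by rewrite addnS -addSn subnKC.
rewrite exprD exprS mulrCA [leRHS]mulrC ler_wpM2l ?exprn_ge0 ?(ltW t0) //.
move: te; rewrite ltr_pdivlMr // mulrC => /ltW te.
by rewrite mulrA -[leRHS]mulr1 ler_pM ?mulr_ge0 ?exprn_ge0 ?exprn_ile1 // ltW.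
Qed.

(** The behaviour of [p] near the line z2 = a z1 becomes behaviour near z2 = 0. *)
Definition shear (a : C) p : {poly {poly C}} :=
  \sum_(k : idx p) (p`_k.1`_k.2)%:P%:P *
    ('X^(k.1) * (a%:P%:P * 'X + 'X%:P) ^+ k.2).

Lemma eval2_shear a p x y : eval2 (shear a p) (x, y) = eval2 p (x, a * x + y).
Proof.
rewrite [RHS]eval2E /eval2 /= !horner_sum; apply: eq_bigr => k _.
by rewrite !(hornerM, hornerC, horner_exp, hornerD, hornerX).
Qed.

End Bivariate.

(** * The Newton polygon of a stable polynomial *)

Section NewtonPolygon.
Variable R : realType.
Local Notation C := R[i].
Implicit Types (P : {poly {poly C}}).

(** Nonvanishing on the product of half-planes, taken to the boundary in the first variable; this
    form survives real shears and suits weighted rescalings. *)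
Definition real_slices_stable P := forall y : R, stable_or_zero P.[y%:C%:P].

Definition expi (x : R) : C := cos x +i* sin x.

Lemma expiX x n : expi x ^+ n = expi (x *+ n).
Proof.
elim: n => [|n IH]; first by rewrite expr0 mulr0n /expi cos0 sin0.
rewrite exprS IH mulrS /expi cosD sinD; apply/eqP; rewrite eq_complex /=.
by rewrite eqxx /= addrC eqxx.
Qed.

(** The coefficient of e^W in P(s e^b, e^a v), as a polynomial in v; when W is the least weight it
    describes an edge of the Newton polygon. *)
Definition edge_poly P (a b W : nat) (s : C) : {poly C} :=
  \sum_(k : idx P | (b * k.1 + a * k.2 == W)%N)
     (P`_k.1`_k.2 * s ^+ k.1) *: 'X^(k.2).

Lemma horner_edge_poly P a b W s v : (edge_poly P a b W s).[v] =
  \sum_(k : idx P | (b * k.1 + a * k.2 == W)%N)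
     P`_k.1`_k.2 * s ^+ k.1 * v ^+ k.2.
Proof.
by rewrite horner_sum; apply: eq_bigr => k _; rewrite hornerZ hornerXn.
Qed.

Lemma coef_edge_poly P a b W s i j : (0 < b)%N -> (b * i + a * j = W)%N ->
  (edge_poly P a b W s)`_j = P`_i`_j * s ^+ i.
Proof.
move=> b0 ijW; rewrite coef_sum -sum_coef2 mulr_suml.
rewrite big_mkcond [RHS]big_mkcond /=; apply: eq_bigr => k _.
rewrite coefZ coefXn [j == _]eq_sym.
have [kj|] := eqVneq (k.2 : nat) j; last by rewrite mulr0 andbF; case: ifP.
have -> : ((b * k.1 + a * k.2)%N == W) = (k.1 == i :> nat).
  by rewrite kj -ijW eqn_add2r eqn_pmul2l.
by case: eqP => //= ->; rewrite mulr1.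
Qed.

Lemma coef_edge_poly0 P a b W s j :
  (forall i, (b * i + a * j)%N != W) -> (edge_poly P a b W s)`_j = 0.
Proof.
move=> jW; rewrite coef_sum big1 // => k /eqP kW.
rewrite coefZ coefXn; case: eqP => [jk|_]; last by rewrite mulr0.
by have := jW k.1; rewrite jk kW eqxx.
Qed.

Lemma edge_monomial (s e v : C) (a b i j : nat) :
  (s * e ^+ b) ^+ i * (e ^+ a * v) ^+ j =
  s ^+ i * (v ^+ j * e ^+ (b * i + a * j)).
Proof.
rewrite !exprMn -!exprM exprD.
move: (s ^+ i) (v ^+ j) (e ^+ (b * i)) (e ^+ (a * j)) => *; ring.
Qed.

(** For e > 0, P(s e^b, e^a v) / e^W is a real slice with v rescaled by a positive number, hence
    stable or zero; the edge polynomial is its limit as e tends to 0. *)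
Lemma edge_poly_stable P a b W (s : R) : (0 < b)%N -> (0 < a)%N ->
  real_slices_stable P ->
  (forall i j, P`_i`_j != 0 -> (W <= b * i + a * j)%N) ->
  stable_or_zero (edge_poly P a b W s%:C).
Proof.
move=> b0 a0 Ps PW.
(* The truncated subtraction is harmless: terms of weight below [W] have zero coefficient. *)
pose F : {poly {poly C}} := \sum_(k : idx P)
  (P`_k.1`_k.2 * s%:C ^+ k.1)%:P%:P * 'X^(b * k.1 + a * k.2 - W) * 'X%:P ^+ k.2.
have -> : edge_poly P a b W s%:C = F.[0].
  rewrite /F /edge_poly horner_sum big_mkcond /=; apply: eq_bigr => k _.
  rewrite !(hornerM, hornerC, hornerXn, horner_exp).
  have [->|Pk] := eqVneq P`_k.1`_k.2 0.
    by rewrite !(mul0r, polyC0, scale0r); case: ifP.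
  case: eqP => [->|/eqP kW].
    by rewrite subnn expr0 mulr1 mul_polyC.
  by rewrite expr0n subn_eq0 leqNgt ltn_neqAle eq_sym kW PW // mulr0 mul0r.
have FE (e : R) v : F.[e%:C%:P].[v] * e%:C ^+ W =
    eval2 P (s%:C * e%:C ^+ b, e%:C ^+ a * v).
  rewrite eval2E /F !horner_sum mulr_suml; apply: eq_bigr => k _.
  rewrite !(hornerM, hornerC, horner_exp, hornerX).
  have [->|Pk] := eqVneq P`_k.1`_k.2 0; first by rewrite !mul0r.
  rewrite edge_monomial -[in RHS](subnK (PW _ _ Pk)) exprD.
  by rewrite !mulrA; congr (_ * _); rewrite mulrAC.
apply: stable_limit => e e0 v v0 Fv.
have eC k : e%:C ^+ k != 0 by rewrite expf_eq0 fmorph_eq0 (gt_eqF e0) andbF.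
have sebE : (s * e ^+ b)%:C = s%:C * e%:C ^+ b by rewrite rmorphM rmorphXn.
have P0 : P.[(s * e ^+ b)%:C%:P] = 0.
  apply: (Ps _ (e%:C ^+ a * v)).
    by rewrite -rmorphXn ImZ mulr_gt0 // exprn_gt0.
  have := FE e v; rewrite Fv mul0r /eval2 /= => /esym.
  by rewrite sebE.
apply: poly_eq0 => w; apply: (mulIf (eC W)); rewrite mul0r FE /eval2 /=.
by rewrite -sebE P0 horner0.
Qed.

(** The points (D, m) and (i0, j0) span an edge with exponent a / b strictly between 1 and 2. Its
    polynomial has only real roots for s = 1 and for s = -1, but multiplication by exp(i pi a / b)
    maps the former roots to the latter. *)
Lemma no_steep_edge P (D m a b i0 j0 : nat) : (b < a < 2 * b)%N ->
  real_slices_stable P -> P`_D`_m != 0 ->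
  (forall i j, P`_i`_j != 0 -> (D + m <= i + j)%N) ->
  (forall i j, P`_i`_j != 0 -> (b * D + a * m <= b * i + a * j)%N) ->
  P`_i0`_j0 != 0 -> (j0 < m)%N -> (b * i0 + a * j0 = b * D + a * m)%N -> False.
Proof.
move=> /andP[ba ab] Ps PD Pord PW P0 j0m ijW.
set W := (b * D + a * m)%N in PW ijW *.
have b0 : (0 < b)%N by lia.
have a0 : (0 < a)%N by lia.
case: m => [//|m] in PD Pord W PW j0m ijW *.
pose E s := edge_poly P a b W s.
have Em s : (E s)`_m.+1 = P`_D`_m.+1 * s ^+ D by apply: coef_edge_poly.
(* [m] is now one below the top degree. A monomial there would need b (i - D) = a, which b < a < 2 b
   excludes. *)
have Em1 s : (E s)`_m = 0.
  apply: coef_edge_poly0 => i; apply/eqP => e.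
  have : (b * i = b * D + a)%N by rewrite /W mulnS in e; lia.
  have [iD|Di] := leqP i D; first by nia.
  have [iD|iD] := leqP i D.+1; first by nia.
  by nia.
have sE s : s != 0 -> size (E s) = m.+2.
  move=> s0; apply/eqP; rewrite eqn_leq; apply/andP; split; last first.
    rewrite ltnNge; apply: contra PD => le; have := Em s.
    rewrite nth_default // => /esym/eqP; rewrite mulf_eq0 expf_eq0 (negPf s0).
    by rewrite andbF orbF.
  (* On the edge b (i + j) + (a - b) j is constant, so a larger j would push i + j below the
     order. *)
  apply/leq_sizeP => j mj; rewrite /E.
  have [[i e]|noi] := pselect (exists i, b * i + a * j = W)%N; last first.
    by apply: coef_edge_poly0 => i; apply/eqP => e; apply: noi; exists i.
  rewrite (coef_edge_poly _ _ b0 e).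
  have [->|/Pord ord] := eqVneq P`_i`_j 0; first by rewrite mul0r.
  exfalso; move: e; rewrite /W => e.
  have : (b * (D + m.+1) <= b * (i + j))%N by rewrite leq_pmul2l.
  have : ((a - b) * m.+1 < (a - b) * j)%N by rewrite ltn_pmul2l // subn_gt0.
  rewrite !mulnBl; nia.
have rE (s : R) : s%:C != 0 -> forall v, (E s%:C).[v] = 0 -> Im v = 0.
  move=> s0; apply: (stable_real_roots _ (sE _ s0) (Em1 _)).
  exact: edge_poly_stable.
have E1 : E 1 = E (1%:C) by rewrite rmorph1.
have n1 : (1%:C : C) != 0 by rewrite rmorph1 oner_eq0.
have nN1 : ((-1)%:C : C) != 0 by rewrite rmorphN1 oppr_eq0 oner_eq0.
(* If 0 were the only root, [E 1] would be a monomial of degree [m.+1], against the nonzero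
   coefficient at [j0]. *)
have [r r0 rr] : exists2 r, r != 0 & (E 1).[r] = 0.
  apply: contrapT => nor.
  have [rs prs] := closed_field_poly_normal (E 1).
  have rs0 r : r \in rs -> r = 0.
    move=> rrs; apply/eqP/negP => /negP r0; apply: nor; exists r => //.
    by apply/rootP; rewrite prs rootZ ?root_prod_XsubC // lead_coef_eq0
      -size_poly_eq0 sE ?oner_eq0.
  have : E 1 = lead_coef (E 1) *: 'X^(size rs).
    rewrite {1}prs; congr (_ *: _).
    rewrite big_seq (eq_bigr (fun=> 'X)); last first.
      by move=> r /rs0 ->; rewrite polyC0 subr0.
    by rewrite -big_seq big_const_seq count_predT -Monoid.iteropE.
  move/(congr1 (fun h : {poly C} => h`_j0)).
  rewrite (coef_edge_poly _ _ b0 ijW) coefZ coefXn.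
  have srs : size rs = m.+1.
    apply: succn_inj; rewrite -(sE 1) ?oner_eq0 // prs size_scale.
      by rewrite size_prod_XsubC.
    by rewrite lead_coef_eq0 -size_poly_eq0 sE ?oner_eq0.
  rewrite srs (ltn_eqF j0m) mulr0 expr1n mulr1 => P00.
  by rewrite P00 eqxx in P0.
have Imr : Im r = 0 by apply: (rE 1 n1); rewrite -E1.
(* As w^b = -1, replacing s = 1 by s = -1 and v by w^a v multiplies the edge polynomial by w^W. *)
pose w := expi (pi / b%:R).
have bR : (b%:R : R) != 0 by rewrite pnatr_eq0 -lt0n.
have wb : w ^+ b = -1.
  rewrite expiX -[_ *+ b]mulr_natr divfK // /expi cospi sinpi.
  by apply/eqP; rewrite eq_complex /= oppr0 !eqxx.
have EN : (E (-1)%:C).[w ^+ a * r] = 0.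
  apply: (@etrans _ _ ((E 1).[r] * w ^+ W)); last by rewrite rr mul0r.
  rewrite /E !horner_edge_poly mulr_suml.
  apply: eq_bigr => k /eqP kW.
  rewrite rmorphN1 -wb -[w ^+ b]mul1r -mulrA edge_monomial.
  by rewrite kW !mulrA.
have := rE _ nN1 _ EN; rewrite expiX -[_ *+ a]mulr_natr.
(* The angle pi a / b is pi plus an angle strictly between 0 and pi, so its sine is nonzero and w^a
   r is not real. *)
have -> : pi / b%:R * a%:R = pi * (a%:R / b%:R - 1) + pi :> R by field.
set q := a%:R / b%:R - 1.
have q01 : 0 < q < 1.
  rewrite /q subr_gt0 ltrBlDr ltr_pdivlMr ?ltr0n // ltr_pdivrMr ?ltr0n //.
  by rewrite mul1r -(natrD _ 1 1) -natrM !ltr_nat ba.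
have sq : 0 < sin (pi * q).
  case/andP: q01 => q0 q1.
  by rewrite sin_gt0_pi // mulr_gt0 ?pi_gt0 //= gtr_pMr ?pi_gt0.
rewrite /expi sinDpi cosDpi.
case: r r0 Imr {rr EN} => x y /= xy y0; rewrite y0 mulr0 add0r => /eqP.
rewrite mulf_eq0 oppr_eq0 (gt_eqF sq) /= => /eqP x0.
by move: xy; rewrite eq_complex /= x0 y0 !eqxx.
Qed.

(** A monomial violating the bound balances y^D v^m along v = y^rho with rho = (i - D) / (m - j)
    strictly between 1 and 2. Taking rho minimal gives an edge forbidden by [no_steep_edge]. *)
Lemma newton_order P (D m : nat) :
  real_slices_stable P -> P`_D`_m != 0 ->
  (forall i j, P`_i`_j != 0 -> (D + m <= i + j)%N) ->
  (forall i j, P`_i`_j != 0 -> (i + j = D + m)%N -> (m <= j)%N) ->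
  forall i j, P`_i`_j != 0 -> (D + 2 * m <= i + 2 * j)%N.
Proof.
move=> Ps PD Pord Pmin i j Pij; rewrite leqNgt; apply/negP => bad.
pose isbad (k : idx P) := (P`_k.1`_k.2 != 0) && (k.1 + 2 * k.2 < D + 2 * m)%N.
have [ip jp] := coef2_neq0 Pij.
have bad0 : isbad (Ordinal ip, Ordinal jp) by rewrite /isbad /= Pij bad.
pose f (k : idx P) : R := (k.1 - D)%:R / (m - k.2)%:R.
have badE i' j' : P`_i'`_j' != 0 -> (i' + 2 * j' < D + 2 * m)%N ->
    (j' < m)%N /\ (D + m < i' + j')%N.
  by move=> nz lt; have := Pord _ _ nz; have := Pmin _ _ nz; lia.
case: (Order.TotalTheory.arg_minP f bad0) => -[/= i0 j0] /andP[/= nz0 lt0] fmin.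
have [j0m i0D] := badE _ _ nz0 lt0.
(* Here a = i0 - D and b = m - j0. Violating monomials lie on or above the edge by minimality, the
   others because b < a < 2 b. *)
apply: (@no_steep_edge P D m (i0 - D) (m - j0) i0 j0) => //; [lia| |nia].
move=> i' j' nz; have ord := Pord _ _ nz.
have [lt|ge] := ltnP (i' + 2 * j') (D + 2 * m); last first.
  have [mj|jm] := leqP m j'; first by nia.
  nia.
have [j'm i'D] := badE _ _ nz lt.
have [ip' jp'] := coef2_neq0 nz.
have := fmin (Ordinal ip', Ordinal jp'); rewrite /isbad /= nz lt => /(_ isT).
rewrite /f /= ler_pdivrMr ?ltr0n ?subn_gt0 // mulrAC.
rewrite ler_pdivlMr ?ltr0n ?subn_gt0 //.
rewrite -!natrM ler_nat; nia.
Qed.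

End NewtonPolygon.

(** * Comparison of monomials with the leading one *)

Section Estimates.
Variable R : realType.
Local Notation C := R[i].
Implicit Types (p g : {poly {poly C}}) (x y a t : R).

Definition order_ge p d := forall i j, p`_i`_j != 0 -> (d <= i + j)%N.

(** On the line of slope l the new polynomial is [p] on the line of slope a + l, hence O(t^d). Only
    values are related, so this serves the inverse shear too. *)
Lemma order_ge_shear p p' (a : C) d :
  (forall x y : C, eval2 p' (x, y) = eval2 p (x, a * x + y)) ->
  order_ge p d -> order_ge p' d.
Proof.
move=> pp' pd i j; apply: contraNT; rewrite -ltnNge => ijd; apply/eqP.
apply: (@weighted_bigO R p' 1 1 d); rewrite ?oner_neq0 ?mul1n // => l _.
have [K K0 hK] : exists2 K : R, 0 < K & forall t, 0 < t <= 1 ->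
    normc (eval2 p (1 * t%:C, (a + l%:C) * (1 * t%:C) ^+ 1)) <= K * t ^+ d.
  by apply: weighted_bigO_eval => i' j'; rewrite mul1n; apply: pd.
exists K => // t /hK; rewrite pp' mul1r !expr1 mulrDl //.
Qed.

Lemma shear_stable p (a : R) :
  real_slices_stable p -> real_slices_stable (shear a%:C p).
Proof.
move=> ps y v v0; rewrite -[_.[v]]/(eval2 (shear a%:C p) (y%:C, v)) eval2_shear.
move=> pv; apply: poly_eq0 => w.
rewrite -[LHS]/(eval2 (shear a%:C p) (y%:C, w)) eval2_shear /eval2 /=.
rewrite (ps y (a%:C * y%:C + v)) ?horner0 //.
by case: v v0 {pv} => v1 v2 /=; rewrite !(mulr0, mul0r, addr0, add0r).
Qed.

(** Position of (i, j) relative to (D, m): for j < m, powers of x^2 will be traded for powers of v;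
    for i < D, powers of v for powers of x; otherwise a positive power is left over. *)
Lemma exponent_cases (D m i j : nat) :
  (D + m <= i + j)%N -> (D + 2 * m <= i + 2 * j)%N ->
  (i + j = D + m -> m < j)%N ->
  [\/ exists k l, (m = j + k.+1 /\ i = D + 2 * k.+1 + l)%N,
      exists k l, [/\ j = m + k, i = D + l & 0 < k + l]%N |
      exists l n, (D = i + l.+1 /\ j = m + (l.+1 + n))%N].
Proof.
move=> ord1 ord2 strict; have [mj|jm] := leqP m j; last first.
  by apply: Or31; exists (m - j).-1, (i - (D + 2 * (m - j)))%N; lia.
have [Di|iD] := leqP D i.
  by apply: Or32; exists (j - m)%N, (i - D)%N; split; lia.
by apply: Or33; exists (D - i).-1, (j - m - (D - i))%N; lia.
Qed.

(** The hypotheses place v between x^2 / eta and eta x. Trading x^2 for v, or v for x, gains a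
    factor eta, as does any leftover positive power of x or v. *)
Lemma monomial_le_lead x v eta (D m i j : nat) :
  0 < x <= eta -> eta <= 1 -> 0 < v <= eta * x -> x ^+ 2 <= eta * v ->
  (D + m <= i + j)%N -> (D + 2 * m <= i + 2 * j)%N ->
  (i + j = D + m -> m < j)%N ->
  x ^+ i * v ^+ j <= eta * (x ^+ D * v ^+ m).
Proof.
move=> /andP[x0 xe] e1 /andP[v0 vx] xv ord1 ord2 strict.
have e0 : 0 < eta by apply: lt_le_trans xe.
have x1 : x <= 1 by apply: le_trans e1.
have ve : v <= eta by rewrite (le_trans vx) // ler_piMr // ltW.
have v1 : v <= 1 by apply: le_trans e1.
have xX k : 0 < x ^+ k by rewrite exprn_gt0.
have vX k : 0 < v ^+ k by rewrite exprn_gt0.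
have pow_le k : (0 < k)%N -> eta ^+ k <= eta.
  by case: k => // k _; rewrite exprS ler_piMr ?(ltW e0) // exprn_ile1 // ltW.
have [[k[l[mE iE]]]|[k[l[jE iE kl]]]|[l[n[DE kE]]]] :=
  exponent_cases ord1 ord2 strict.
- clear ord1 ord2 strict.
  rewrite mE iE !exprD exprM.
  have h : (x ^+ 2) ^+ k.+1 * x ^+ l <= eta * v ^+ k.+1.
    rewrite -[leRHS]mulr1 ler_pM ?exprn_ge0 ?(ltW x0) //; last first.
      by rewrite exprn_ile1 // ltW.
    apply: (@le_trans _ _ ((eta * v) ^+ k.+1)).
      by apply: lerXn2r xv; rewrite nnegrE ?sqr_ge0 // mulr_ge0 // ltW.
    by rewrite exprMn ler_wpM2r ?pow_le // ltW.
  have := ler_wpM2l (ltW (mulr_gt0 (xX D) (vX j))) h.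
  move: (x ^+ D) (v ^+ j) ((x ^+ 2) ^+ k.+1) (x ^+ l) (v ^+ k.+1) => *; lra.
- rewrite iE jE !exprD.
  have h : x ^+ l * v ^+ k <= eta.
    have [l0|l0] := posnP l.
      rewrite l0 expr0 mul1r.
      move: kl; rewrite l0 addn0; case: k {jE} => // k _.
      by rewrite exprS -[leRHS]mulr1 ler_pM ?exprn_ge0 ?exprn_ile1 // ltW.
    case: l l0 {iE kl} => // l _.
    rewrite exprS -[leRHS]mulr1 -[X in _ <= X * _]mulr1.
    by rewrite !ler_pM ?mulr_ge0 ?exprn_ge0 ?exprn_ile1 // ltW.
  have := ler_wpM2l (ltW (mulr_gt0 (xX D) (vX m))) h.
  move: (x ^+ D) (v ^+ m) (x ^+ l) (v ^+ k) => *; lra.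
- rewrite DE kE !exprD.
  have h : v ^+ l.+1 * v ^+ n <= eta * x ^+ l.+1.
    rewrite -[leRHS]mulr1 ler_pM ?exprn_ge0 ?(ltW v0) //; last first.
      by rewrite exprn_ile1 // ltW.
    apply: (@le_trans _ _ ((eta * x) ^+ l.+1)).
      by apply: lerXn2r vx; rewrite nnegrE ?mulr_ge0 // ltW.
    by rewrite exprMn ler_wpM2r ?pow_le // ltW.
  have := ler_wpM2l (ltW (mulr_gt0 (xX i) (vX m))) h.
  move: (x ^+ i) (v ^+ m) (v ^+ l.+1) (v ^+ n) (x ^+ l.+1) => *; lra.
Qed.

End Estimates.

(** * Estimates near and away from the tangent lines *)

Section HornEstimates.
Variable R : realType.
Local Notation C := R[i].
Implicit Types (p g : {poly {poly C}}) (x y a t eta : R).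

(** The errors cost at most half of c L in the lower bound for [np], and [ng] is at most eps times
    that half. *)
Lemma lead_dominates (eps c S1 S2 eta L np ng : R) :
  0 < eps -> 0 <= eta -> 0 <= L ->
  eta * (1 + S1) <= c / 2 -> eta * (1 + S2) <= eps * c / 2 ->
  c * L <= np + S1 * (eta * L) -> ng <= S2 * (eta * L) -> ng <= eps * np.
Proof.
move=> eps0 eta0 L0 h1 h2 hp hg.
have eL : 0 <= eta * L by rewrite mulr_ge0.
have := ler_wpM2r L0 h1; have := ler_wpM2r L0 h2 => a1 a2.
have b2 : c * L / 2 <= np by lra.
by have := ler_wpM2l (ltW eps0) b2; lra.
Qed.

Definition coef_norm p : R := \sum_(k : idx p) normc p`_k.1`_k.2.

Lemma coef_norm_ge0 p : 0 <= coef_norm p.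
Proof. by rewrite sumr_ge0 // => k _; apply: normc_ge0. Qed.

Lemma partial_eval_le p (Q : pred (idx p)) x y (B : R) : 0 <= B ->
  (forall k, Q k -> p`_k.1`_k.2 != 0 -> `|x| ^+ k.1 * `|y| ^+ k.2 <= B) ->
  normc (\sum_(k : idx p | Q k) p`_k.1`_k.2 * (x%:C ^+ k.1 * y%:C ^+ k.2)) <=
    coef_norm p * B.
Proof.
move=> B0 pB; rewrite (le_trans (normc_sum _ _ _)) // /coef_norm mulr_suml.
rewrite big_mkcond /= ler_sum // => k _.
case: ifP => [Qk|_]; last by rewrite mulr_ge0 ?normc_ge0.
have [->|pk] := eqVneq p`_k.1`_k.2 0.
  by rewrite mul0r Normc.normc0 mul0r.
rewrite Normc.normcM ler_wpM2l ?normc_ge0 //.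
by rewrite Normc.normcM !normcX !normcR pB.
Qed.

Section Pair.
Variables (p g : {poly {poly C}}) (M : nat) (K : R).
Hypothesis p_stable : real_slices_stable p.
Hypothesis g_dom : 0 <= K /\ forall x y,
  normc (eval2 g (x%:C, y%:C)) <= K * normc (eval2 p (x%:C, y%:C)).
Hypothesis p_order : order_ge p M.
Hypothesis p_lead : exists i j, (i + j)%N = M /\ p`_i`_j != 0.
Hypothesis g_order : order_ge g M.+1.

(** The shear is undone by the shear with -a, so if it lost all terms of degree [M], [p] would have
    order at least M + 1. *)
Lemma shear_lead a :
  exists i j, (i + j)%N = M /\ (shear a%:C p)`_i`_j != 0.
Proof.
apply: contrapT => nolead.
have [i [j [ijM]]] := p_lead; apply/negP; rewrite negbK; apply/eqP.
apply: contrapT => /eqP pij.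
have : order_ge p M.+1.
  apply: (@order_ge_shear _ (shear a%:C p) _ (- a%:C)).
    by move=> x y; rewrite eval2_shear mulNr addNKr.
  move=> i' j' nz; rewrite ltn_neqAle.
  have ->: (M <= i' + j')%N.
    by apply: (order_ge_shear (a := a%:C) _ p_order) nz => x y;
      rewrite eval2_shear.
  by rewrite andbT; apply/eqP => e; apply: nolead; exists i', j'.
by move/(_ i j pij); rewrite ijM ltnn.
Qed.

(** With v = y - a x, the region is a thin sector about the line minus a parabolic neighbourhood of
    the line; there x^D v^m dominates the other monomials of [P] and all those of [G]. *)
Lemma horn_estimate a (eps : R) : 0 < eps -> exists2 eta : R, 0 < eta <= 1 &
  forall x y, 0 < `|x| <= eta -> `|y - a * x| <= eta * `|x| ->
    x ^+ 2 <= eta * `|y - a * x| ->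
    normc (eval2 g (x%:C, y%:C)) <= eps * normc (eval2 p (x%:C, y%:C)).
Proof.
move=> eps0.
pose P := shear a%:C p; pose G := shear a%:C g.
have Pord : order_ge P M.
  by apply: (order_ge_shear (a := a%:C) _ p_order) => x y; rewrite eval2_shear.
have Gord : order_ge G M.+1.
  by apply: (order_ge_shear (a := a%:C) _ g_order) => x y; rewrite eval2_shear.
have exm : exists m, (m <= M)%N && (P`_(M - m)`_m != 0).
  have [i [j [ijM nz]]] := shear_lead a; exists j.
  by rewrite -ijM leq_addl addnK.
(* [m] is the multiplicity of v as a factor of the lowest homogeneous part of [P]. *)
case: (ex_minnP exm) => m /andP[mM Pm] mmin.
pose D := (M - m)%N; have MD : M = (D + m)%N by rewrite subnK.
have Pmin i j : P`_i`_j != 0 -> (i + j = D + m)%N -> (m <= j)%N.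
  move=> nz; rewrite -MD => e; apply: mmin.
  by rewrite -e leq_addl addnK nz.
rewrite MD in Pord Gord.
have Pord2 := newton_order (shear_stable (a := a) p_stable) Pm Pord Pmin.
(* [G] inherits the weighted bound from [P], being at most K times [P] in modulus along each curve
   (t, l t^2). *)
have Gord2 i j : G`_i`_j != 0 -> (D + 2 * m <= i + 2 * j)%N.
  apply: contraNT; rewrite -ltnNge => lt; apply/eqP.
  apply: (@weighted_bigO R G 1 2 (D + 2 * m)) lt; rewrite ?oner_neq0 // => l _.
  have [K1 K10 hK1] := @weighted_bigO_eval R P 1 l%:C 2 (D + 2 * m) Pord2.
  case: g_dom => K0 gp.
  exists ((1 + K) * K1); first by rewrite mulr_gt0 // ltr_pwDl.
  move=> t t01; have := hK1 t t01.
  rewrite mul1r -rmorphXn -rmorphM !eval2_shear -rmorphM -rmorphD => h.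
  rewrite (le_trans (gp _ _)) //.
  have n0 := normc_ge0 (eval2 p (t%:C, (a * t + l * t ^+ 2)%:C)).
  have := ler_wpM2l (addr_ge0 ler01 K0) h; rewrite mulrDl mul1r; lra.
pose c := normc P`_D`_m; have c0 : 0 < c by rewrite normc_gt0.
have SP := coef_norm_ge0 P; have SG := coef_norm_ge0 G.
pose eta := Num.min 1 (Num.min (c / 2 / (1 + coef_norm P))
                               (eps * c / 2 / (1 + coef_norm G))).
have eta0 : 0 < eta by rewrite !lt_min ltr01 !divr_gt0 ?mulr_gt0 ?ltr_pwDl.
have eta1 : eta <= 1 by rewrite ge_min lexx.
exists eta; first by rewrite eta0.
move=> x y; set v := y - a * x => x0 vx xv.
have etaP : eta * (1 + coef_norm P) <= c / 2.
  by rewrite -ler_pdivlMr ?ltr_pwDl // !ge_min lexx orbT.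
have etaG : eta * (1 + coef_norm G) <= eps * c / 2.
  by rewrite -ler_pdivlMr ?ltr_pwDl // !ge_min lexx !orbT.
have v0 : 0 < `|v|.
  have x2 : 0 < x ^+ 2 by rewrite exprn_even_gt0 //= -normr_gt0; case/andP: x0.
  by have := lt_le_trans x2 xv; rewrite pmulr_rgt0.
have evalE (q : {poly {poly C}}) :
    eval2 q (x%:C, y%:C) = eval2 (shear a%:C q) (x%:C, v%:C).
  by rewrite eval2_shear -rmorphM -rmorphD addrC subrK.
pose L := `|x| ^+ D * `|v| ^+ m.
have L0 : 0 < L by rewrite mulr_gt0 ?exprn_gt0 //; case/andP: x0.
have term i j : (D + m <= i + j)%N -> (D + 2 * m <= i + 2 * j)%N ->
    (i + j = D + m -> m < j)%N -> `|x| ^+ i * `|v| ^+ j <= eta * L.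
  apply: monomial_le_lead => //; first by rewrite v0 vx.
  by rewrite -normrX ger0_norm ?sqr_ge0.
have GL : normc (eval2 g (x%:C, y%:C)) <= coef_norm G * (eta * L).
  rewrite evalE eval2E.
  apply: partial_eval_le => [|k _ nz]; first by rewrite mulr_ge0 ?ltW.
  (* [G] has order at least M + 1, so the case i + j = D + m is void. *)
  by apply: term (Gord2 _ _ nz) _ => [|e]; have := Gord _ _ nz;
    rewrite ?e ?ltnn // => /ltnW.
have [Dp mp] := coef2_neq0 Pm.
have PL : c * L <= normc (eval2 p (x%:C, y%:C)) + coef_norm P * (eta * L).
  rewrite evalE eval2E (bigD1 (Ordinal Dp, Ordinal mp)) //=.
  set T := P`_D`_m * _; set U := \sum_(i | _) _.
  have -> : c * L = normc T.
    by rewrite /T !Normc.normcM !normcX !normcR.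
  rewrite -{1}(addrK U T) (le_trans (normcB _ _)) // lerD2l.
  apply: partial_eval_le => [|k kDm nz]; first by rewrite mulr_ge0 ?ltW.
  apply: term (Pord _ _ nz) (Pord2 _ _ nz) _ => e.
  (* The only pair with i + j = D + m and j = m is (D, m), which was split off the sum. *)
  rewrite ltn_neqAle (Pmin _ _ nz e) andbT; apply: contraNneq kDm => mk.
  have kD : k.1 = D :> nat by apply/eqP; rewrite -(eqn_add2r m) {1}mk e.
  by rewrite -pair_eqE /pair_eq /= -!val_eqE /= kD -mk !eqxx.
exact: lead_dominates eps0 (ltW eta0) (ltW L0) etaP etaG PL GL.
Qed.

(** The lowest homogeneous part of [p] at z1 = 1; its real roots are the slopes of the real lines,
    other than the z2-axis, on which that part vanishes. *)
Definition lead_poly := edge_poly p 1 1 M 1.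

Lemma lead_poly_neq0 : lead_poly != 0.
Proof.
have [i [j [ijM nz]]] := p_lead.
apply: contra nz => /eqP /(congr1 (fun h : {poly C} => h`_j)).
by rewrite coef0 (@coef_edge_poly _ _ _ _ _ _ i) ?mul1n // expr1n mulr1 => ->.
Qed.

(** The lowest part is x^M times [lead_poly] at y / x, and |y / x - r| >= |y / x - Re r| >= kappa
    bounds it below by c |x|^M; all other terms are O(|x|^(M + 1)). *)
Lemma off_horn_estimate (rs : seq C) (B kappa eps : R) :
  lead_poly = lead_coef lead_poly *: \prod_(r <- rs) ('X - r%:P) ->
  1 <= B -> 0 < kappa -> 0 < eps -> exists2 delta : R, 0 < delta &
  forall x y, 0 < `|x| <= delta -> `|y| <= B * `|x| ->
    (forall r, r \in rs -> kappa * `|x| <= `|y - Re r * x|) ->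
    normc (eval2 g (x%:C, y%:C)) <= eps * normc (eval2 p (x%:C, y%:C)).
Proof.
move=> rsE B1 kappa0 eps0.
pose c := normc (lead_coef lead_poly) * kappa ^+ size rs.
have c0 : 0 < c.
  by rewrite mulr_gt0 ?exprn_gt0 // normc_gt0 lead_coef_eq0 lead_poly_neq0.
have B0 : 0 < B by apply: lt_le_trans B1.
have SP := coef_norm_ge0 p; have SG := coef_norm_ge0 g.
have BX (q : {poly {poly C}}) : 0 < B ^+ sizeY q by rewrite exprn_gt0.
pose Sp := coef_norm p * B ^+ sizeY p; pose Sg := coef_norm g * B ^+ sizeY g.
have Sp0 : 0 <= Sp by rewrite mulr_ge0 // ltW.
have Sg0 : 0 <= Sg by rewrite mulr_ge0 // ltW.
pose delta := Num.min 1 (Num.min (c / 2 / (1 + Sp)) (eps * c / 2 / (1 + Sg))).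
have delta0 : 0 < delta.
  have [d1 d2] : 0 < 1 + Sp /\ 0 < 1 + Sg by rewrite !ltr_pwDl.
  by rewrite !lt_min ltr01 !divr_gt0 // mulr_gt0.
exists delta => // x y /andP[x0 xd] yx yr.
have x1 : `|x| <= 1 by rewrite (le_trans xd) // ge_min lexx.
have xP : `|x| * (1 + Sp) <= c / 2.
  by rewrite -ler_pdivlMr ?ltr_pwDl // (le_trans xd) // !ge_min lexx orbT.
have xG : `|x| * (1 + Sg) <= eps * c / 2.
  by rewrite -ler_pdivlMr ?ltr_pwDl // (le_trans xd) // !ge_min lexx !orbT.
have xM k : 0 < `|x| ^+ k by rewrite exprn_gt0.
(* As B >= 1, a single power of [B] serves every monomial. *)
have term (q : {poly {poly C}}) (k : idx q) : (M < k.1 + k.2)%N ->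
    `|x| ^+ k.1 * `|y| ^+ k.2 <= B ^+ sizeY q * (`|x| * `|x| ^+ M).
  move=> Mk; apply: (@le_trans _ _ (`|x| ^+ k.1 * (B * `|x|) ^+ k.2)).
    by rewrite ler_wpM2l ?(ltW (xM _)) // lerXn2r ?nnegrE // mulr_ge0 // ltW.
  rewrite exprMn mulrCA -exprD -exprS ler_pM ?exprn_ge0 ?(ltW B0) //.
    by rewrite ler_weXn2l // ltnW.
  by rewrite ler_wiXn2l.
have GL : normc (eval2 g (x%:C, y%:C)) <= Sg * (`|x| * `|x| ^+ M).
  rewrite eval2E -mulrA.
  apply: partial_eval_le => [|k _ nz]; first by rewrite !mulr_ge0 ?ltW.
  by apply: term; apply: g_order nz.
have nx0 : x%:C != 0 by rewrite fmorph_eq0 -normr_gt0.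
have PL : c * `|x| ^+ M <=
    normc (eval2 p (x%:C, y%:C)) + Sp * (`|x| * `|x| ^+ M).
  rewrite eval2E (bigID (fun k : idx p => (1 * k.1 + 1 * k.2 == M)%N)) /=.
  set T := \sum_(i | _) _; set U := \sum_(i | ~~ _) _.
  have TE : T = x%:C ^+ M * lead_poly.[(y / x)%:C].
    rewrite horner_edge_poly mulr_sumr; apply: eq_bigr => k /eqP <-.
    rewrite !mul1n expr1n mulr1 rmorphM fmorphV exprMn exprD [RHS]mulrCA.
    congr (_ * _).
    rewrite -[RHS]mulrA; congr (_ * _).
    by rewrite mulrCA -exprMn divff // expr1n mulr1.
  apply: (@le_trans _ _ (normc T)).
    rewrite TE Normc.normcM normcX normcR mulrC ler_pM2l //.
    rewrite rsE hornerZ Normc.normcM.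
    rewrite ler_wpM2l ?normc_ge0 // horner_prod normc_prod.
    elim: (rs) yr => [|r s IH] yr; first by rewrite big_nil.
    rewrite big_cons /= exprS ler_pM ?exprn_ge0 ?(ltW kappa0) //; last first.
      by apply: IH => r' r's; apply: yr; rewrite in_cons r's orbT.
    rewrite hornerXsubC (le_trans _ (normc_ge_absRe _)) // ReB /=.
    have -> : y / x - Re r = (y - Re r * x) / x by field; rewrite -normr_gt0.
    by rewrite normrM normfV ler_pdivlMr // yr ?mem_head.
  rewrite -{1}(addrK U T) (le_trans (normcB _ _)) // lerD2l -mulrA.
  apply: partial_eval_le => [|k kM nz]; first by rewrite !mulr_ge0 ?ltW.
  apply: term; rewrite ltn_neqAle p_order // andbT eq_sym.
  by move: kM; rewrite !mul1n.
exact: lead_dominates eps0 (ltW x0) (ltW (xM M)) xP xG PL GL.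
Qed.

End Pair.
End HornEstimates.

(** * From the Schur function to bounds on its numerator and denominator *)

Section SchurPair.
Variable R : realType.
Local Notation C := R[i].
Implicit Types (p q g : {poly {poly C}}) (x y a t eta : R).

Definition half_plane_nonzero p := forall z, bi_half_plane z -> eval2 p z != 0.

Lemma eval2_swapXY p (z w : C) : eval2 (swapXY p) (z, w) = eval2 p (w, z).
Proof. by rewrite /eval2 horner2_swapXY. Qed.

Lemma half_plane_nonzero_swapXY p :
  half_plane_nonzero p -> half_plane_nonzero (swapXY p).
Proof. by move=> p0 [z w] [/= z0 w0]; rewrite eval2_swapXY p0. Qed.

(** The slice at real y is the limit of the slices at y + i e, which have no zeros in the
    half-plane. *)
Lemma half_plane_nonzero_slices p :
  half_plane_nonzero p -> real_slices_stable p.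
Proof.
move=> p0 y.
pose F := p \Po ('X * ('i%C : C)%:P%:P + (y%:C)%:P%:P).
have FE e : F.[e%:P] = p.[(e * 'i%C + y%:C)%:P].
  by rewrite horner_comp !(hornerD, hornerM, hornerX, hornerC) -polyCM -polyCD.
have -> : p.[y%:C%:P] = F.[0] by rewrite -[0]polyC0 FE mul0r add0r.
apply: stable_limit => e e0 v v0; rewrite FE => pv.
suff /p0 : bi_half_plane (e%:C * 'i%C + y%:C, v) by rewrite /eval2 /= pv eqxx.
by split => //=; rewrite !(mulr0, mul0r, mulr1, addr0, add0r).
Qed.

(** Adding i e to both coordinates moves the real point into the half-planes; then e tends to 0. *)
Lemma half_plane_le_real p q : (forall z, bi_half_plane z ->
    normc (eval2 q z) <= normc (eval2 p z)) ->
  forall x y, normc (eval2 q (x%:C, y%:C)) <= normc (eval2 p (x%:C, y%:C)).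
Proof.
move=> qp x y.
pose line (r : {poly {poly C}}) : {poly C} := \sum_(k : idx r)
  (r`_k.1`_k.2)%:P * (('X * ('i%C)%:P + (x%:C)%:P) ^+ k.1 *
                      ('X * ('i%C)%:P + (y%:C)%:P) ^+ k.2).
have lineE r e : (line r).[e] = eval2 r (e * 'i%C + x%:C, e * 'i%C + y%:C).
  rewrite eval2E horner_sum; apply: eq_bigr => k _.
  by rewrite !(hornerM, hornerC, horner_exp, hornerD, hornerX).
have line0 r : eval2 r (x%:C, y%:C) = (line r).[0].
  by rewrite lineE mul0r !add0r.
rewrite !line0 -[leRHS]mul1r; apply: poly_le_at0 => // e /andP[e0 _].
rewrite mul1r !lineE; apply: qp.
by split => /=; rewrite !(mulr0, mul0r, mulr1, addr0, add0r).
Qed.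

Lemma ratfun_sub p q c z : eval2 p z != 0 ->
  ratfun q p z - c = eval2 (q - c%:P%:P * p) z / eval2 p z.
Proof.
by move=> pz; rewrite eval2Z_sub mulrBl mulfK.
Qed.

Lemma order_exists p : p != 0 ->
  exists M, order_ge p M /\ exists i j, (i + j)%N = M /\ p`_i`_j != 0.
Proof.
move=> p0.
pose nz M := [exists k : idx p, (k.1 + k.2 == M)%N && (p`_k.1`_k.2 != 0)].
have nzP i j : p`_i`_j != 0 -> nz (i + j)%N.
  move=> pij; have [ip jp] := coef2_neq0 pij.
  by apply/existsP; exists (Ordinal ip, Ordinal jp); rewrite /= eqxx.
have exM : exists M, nz M.
  have : lead_coef (lead_coef p) != 0 by rewrite !lead_coef_eq0.
  by move/nzP; eexists; eassumption.
case: (ex_minnP exM) => M /existsP[k /andP[/eqP kM pk]] Mmin; exists M; split.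
  by move=> i j /nzP /Mmin.
by exists k.1, k.2.
Qed.

(** On the ray (i t, i l t), which stays in a non-tangential region, q / p - f^* tends to 0 and p =
    O(t^M), so the numerator is o(t^M); letting l vary kills all terms of degree at most M. *)
Lemma nt_order p q (fstar : C) M :
  half_plane_nonzero p -> nt_limit0 (ratfun q p) fstar -> order_ge p M ->
  order_ge (q - fstar%:P%:P * p) M.+1.
Proof.
move=> p0 flim pM i j; apply: contraNltn; rewrite -[j in (i + j)%N]mul1n => ijM.
apply/eqP; apply: (weighted_littleo (u := 'i%C) _ _ ijM).
  by rewrite -normc_eq0 normci oner_neq0.
move=> l l0 e e0.
have [K K0 hK] : exists2 K : R, 0 < K & forall t, 0 < t <= 1 ->
    normc (eval2 p ('i%C * t%:C, l%:C * ('i%C * t%:C) ^+ 1)) <= K * t ^+ M.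
  by apply: weighted_bigO_eval => i' j'; rewrite mul1n; apply: pM.
(* The ratios of moduli and imaginary parts on the ray are 1, l and 1 / l. *)
pose c := Num.max l l^-1.
have c1 : 1 <= c.
  rewrite le_max; have [//|l1] := leP 1 l.
  by rewrite invf_ge1 // ltW.
have /cvgrPdist_lt/(_ (e / K)%:C) := flim c c1.
rewrite ltcR divr_gt0 // => /(_ isT); rewrite near_withinE.
move=> /nbhs_ballP[d /= d0 dball].
(* The radius is an element of [R[i]]; being positive, it is real. *)
have [s sd] : exists s : R, d = s%:C.
  by exists (Re d); rewrite RRe_real // gtr0_real.
rewrite sd ltcR in d0 dball.
exists (Num.min 1 (Num.min s (s / l))).
  by rewrite !lt_min ltr01 d0 divr_gt0.
move=> t; rewrite !lt_min ltr_pdivlMr // => /and4P[t0 t1 ts tls].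
set z := (_, _).
have zE : z = (0 +i* t, 0 +i* (l * t)).
  rewrite /z expr1; congr (_, _); apply/eqP; rewrite eq_complex /=; apply/andP.
    by split; apply/eqP; ring.
  by split; apply/eqP; ring.
have lt0 : 0 < l * t by rewrite mulr_gt0.
have normi a : 0 < a -> normc (0 +i* a) = a.
  by move=> a0; rewrite /= expr0n add0r sqrtr_sqr gtr0_norm.
have zH : bi_half_plane z by rewrite zE.
have c0 : 0 < c by apply: lt_le_trans c1.
have zt : nt_region c z.
  have n1 : normc z.1 = t by rewrite zE normi.
  have n2 : normc z.2 = l * t by rewrite zE normi.
  have i1 : Im z.1 = t by rewrite zE.
  have i2 : Im z.2 = l * t by rewrite zE.
  split => // a b; rewrite n1 n2 i1 i2 !inE.
  have [lc ic] : l <= c /\ l^-1 <= c by rewrite !le_max !lexx orbT.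
  have ab (a' b' : R) : 0 < a' -> 0 < b' -> a' <= c * b' -> b' <= c * a' ->
      c^-1 <= a' / b' <= c.
    by move=> a0 b0 h1 h2; rewrite ler_pdivrMr // h1 ler_pdivlMr // mulrC
      ler_pdivrMr // mulrC h2.
  have h1 : t <= c * (l * t).
    by rewrite mulrA ler_peMl ?(ltW t0) // -ler_pdivrMr // mul1r.
  have h2 : l * t <= c * t by rewrite ler_pM2r.
  have h3 (a' : R) : 0 < a' -> a' <= c * a'.
    by move=> a0; rewrite ler_peMl // ltW.
  by do 2![case/or4P => /eqP ->]; apply: ab => //; apply: h3.
have zball : ball (0 : C * C) s%:C z.
  rewrite zE; split; rewrite /ball /= sub0r normrN normr_normc normi //.
  - by rewrite ltcR.
  - by rewrite ltcR mulrC.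
have pz := p0 _ zH.
have := dball z zball zt.
rewrite /= distrC ratfun_sub // normr_normc ltcR Normc.normcM Normc.normcV.
rewrite ltr_pdivrMr ?normc_gt0 // => /ltW h; rewrite (le_trans h) //.
have := hK t; rewrite t0 (ltW t1) => /(_ isT) h'.
rewrite (le_trans (ler_wpM2l (ltW (divr_gt0 e0 K0)) h')) //.
by rewrite mulrA divfK // gt_eqF.
Qed.

End SchurPair.

(** * Combination of the estimates near the origin *)

Section NearOrigin.
Variable R : realType.
Local Notation C := R[i].
Variables (p g : {poly {poly C}}) (M : nat) (K : R).
Hypothesis p_nonzero : half_plane_nonzero p.
Hypothesis g_dom : 0 <= K /\ forall x y : R,
  normc (eval2 g (x%:C, y%:C)) <= K * normc (eval2 p (x%:C, y%:C)).
Hypothesis p_order : order_ge p M.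
Hypothesis p_lead : exists i j, (i + j)%N = M /\ p`_i`_j != 0.
Hypothesis g_order : order_ge g M.+1.

(** Exchanging the variables reduces this to slope 0; [half_plane_nonzero], unlike
    [real_slices_stable], is symmetric in them. *)
Lemma axis_horn_estimate (eps : R) : 0 < eps -> exists2 eta : R, 0 < eta <= 1 &
  forall x y : R, 0 < `|y| <= eta -> `|x| <= eta * `|y| ->
    y ^+ 2 <= eta * `|x| ->
    normc (eval2 g (x%:C, y%:C)) <= eps * normc (eval2 p (x%:C, y%:C)).
Proof.
move=> eps0.
have order_swap r d : order_ge r d -> order_ge (swapXY r) d.
  by move=> rd i j; rewrite coef_swapXY addnC; apply: rd.
have [|||||eta eta01 h] :=
  @horn_estimate R (swapXY p) (swapXY g) M K _ _ _ _ _ 0 eps eps0.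
- exact/half_plane_nonzero_slices/half_plane_nonzero_swapXY.
- by case: g_dom => K0 gp; split => // x y; rewrite !eval2_swapXY.
- exact: order_swap.
- have [i [j [ij nz]]] := p_lead; exists j, i.
  by rewrite addnC coef_swapXY.
- exact: order_swap.
exists eta => // x y y0 xy yx; have := h y x y0.
by rewrite !mul0r !subr0 !eval2_swapXY; apply.
Qed.

Lemma horns_estimate (s : seq R) (eps : R) : 0 < eps ->
  exists2 eta : R, 0 < eta <= 1 &
  forall a, a \in s -> forall x y : R,
    0 < `|x| <= eta -> `|y - a * x| <= eta * `|x| ->
    x ^+ 2 <= eta * `|y - a * x| ->
    normc (eval2 g (x%:C, y%:C)) <= eps * normc (eval2 p (x%:C, y%:C)).
Proof.
move=> eps0; elim: s => [|a s [e1 /andP[e10 e11] IH]].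
  by exists 1 => //; rewrite ltr01 lexx.
have [e2 /andP[e20 e21] h] :=
  horn_estimate (half_plane_nonzero_slices p_nonzero)
    g_dom p_order p_lead g_order a eps0.
exists (Num.min e1 e2); first by rewrite lt_min e10 e20 ge_min e11.
move=> b bs x y; rewrite le_min => /and3P[x0 x1 x2] y1 y2.
have weak e : Num.min e1 e2 <= e ->
    `|y - b * x| <= e * `|x| /\ x ^+ 2 <= e * `|y - b * x|.
  move=> le; split.
    by rewrite (le_trans y1) // ler_wpM2r.
  by rewrite (le_trans y2) // ler_wpM2r.
have [|w1 w2] := weak e1; first by rewrite ge_min lexx.
have [|w3 w4] := weak e2; first by rewrite ge_min lexx orbT.
move: bs; rewrite in_cons => /orP[/eqP ba|bs].
  by apply: h; rewrite -?ba ?x0.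
by apply: (IH b) => //; rewrite x0.
Qed.

(** A punctured neighbourhood is covered by a sector about the z2-axis, sectors about the lines of
    slope Re r, and the rest, each with its own estimate. *)
Lemma near_origin_estimate (rs : seq C) (eps : R) : 0 < eps ->
  lead_poly p M = lead_coef (lead_poly p M) *: \prod_(r <- rs) ('X - r%:P) ->
  exists B d : R, [/\ 0 < B, 0 < d & forall x y : R, (x != 0) || (y != 0) ->
    `|x| <= d -> `|y| <= d -> B * y ^+ 2 < `|x| ->
    (forall a, a \in map (@complex.Re R) rs -> B * x ^+ 2 < `|y - a * x|) ->
    normc (eval2 g (x%:C, y%:C)) <= eps * normc (eval2 p (x%:C, y%:C))].
Proof.
move=> eps0 rsE.
have [e1 /andP[e10 e11] h1] := axis_horn_estimate eps0.
have [e2 /andP[e20 e21] h2] := horns_estimate (map (@complex.Re R) rs) eps0.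
(* Off the sector |x| <= e1 |y| one has |y| <= e1^-1 |x|; off the other sectors kappa = e2 works. *)
have [|d d0 h3] :=
  off_horn_estimate p_order p_lead g_order rsE (B := e1^-1) _ e20 eps0.
  by rewrite invf_ge1.
(* Large enough to turn B u^2 < w, the condition off a horn, into u^2 <= e w for both values of
   e. *)
pose B := Num.max e1^-1 e2^-1.
have Be1 : e1^-1 <= B by rewrite le_max lexx.
have Be2 : e2^-1 <= B by rewrite le_max lexx orbT.
have B0 : 0 < B by rewrite (lt_le_trans _ Be1) // invr_gt0.
exists B, (Num.min d (Num.min e1 e2)); split => //.
  by rewrite !lt_min d0 e10.
move=> x y xy0; rewrite !le_min => /and3P[xd xe1 xe2] /and3P[yd ye1 ye2] xB yB.
have large (e u w : R) : 0 < e -> e^-1 <= B -> B * u ^+ 2 < w ->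
    u ^+ 2 <= e * w.
  move=> e0 eB /ltW h; rewrite -ler_pdivrMl //; apply: le_trans h.
  by rewrite ler_wpM2r // sqr_ge0.
have [xy|xy] := leP `|x| (e1 * `|y|).
  have y0 : 0 < `|y|.
    rewrite normr_gt0; apply/eqP => y0; move: xy xy0.
    by rewrite y0 normr0 mulr0 normr_le0 eqxx orbF => ->.
  apply: h1 => //; first by rewrite y0.
  exact: large xB.
have x0 : 0 < `|x| by rewrite (le_lt_trans _ xy) // mulr_ge0 // ltW.
have [[a as_ close]|far] := pselect (exists2 a, a \in map (@complex.Re R) rs &
    `|y - a * x| <= e2 * `|x|).
  apply: (h2 a) => //; first by rewrite x0.
  exact: large (yB _ as_).
apply: h3 => [||r rrs]; first by rewrite x0.
  by rewrite mulrC ler_pdivlMr // mulrC ltW.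
rewrite leNgt; apply/negP => /ltW close; apply: far.
by exists (Re r) => //; apply: map_f.
Qed.

End NearOrigin.

(** * Choice of the slopes and conclusion *)

Theorem theorem4p3 (R : realType) (q p : {poly {poly R[i]}}) (fstar : R[i])
  (hlow : lowest_terms q p)
  (hschur : rational_schur q p)
  (hnonconst : nonconstant q p)
  (hsing : eval2 p (0, 0) = 0)
  (hfstar : nt_limit0 (ratfun q p) fstar) :
  exists (L : nat) (slope : 'I_L -> option R),
    forall (x : nat -> R * R) (zeta0 : R[i]),
      (forall n, eval2 p (real_pt (x n)) != 0) ->
      x n @[n --> \oo] --> ((0, 0) : R * R) ->
      ratfun q p (real_pt (x n)) @[n --> \oo] --> zeta0 ->
      zeta0 != fstar ->
      exists H : 'I_L -> set (R * R),
        (forall l, is_horn (slope l) (H l)) /\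
        \forall n \near \oo, (\bigcup_l H l) (x n).
Proof.
have p_nonzero : half_plane_nonzero p by move=> z /hschur[].
have p0 : p != 0.
  apply/eqP => p0.
  have : bi_half_plane ('i%C : R[i], 'i%C : R[i]) by split => /=.
  by move/p_nonzero; rewrite p0 /eval2 !horner0 eqxx.
have [M [p_order p_lead]] := order_exists p0.
pose g := q - fstar%:P%:P * p.
have g_order : order_ge g M.+1 by apply: nt_order.
have qp z : bi_half_plane z -> normc (eval2 q z) <= normc (eval2 p z).
  move=> zH; have [pz _] := hschur z zH.
  rewrite normr_normc -[1]/(1%:C) lecR Normc.normcM Normc.normcV.
  by rewrite ler_pdivrMr ?normc_gt0 // mul1r.
have g_dom : 0 <= 1 + normc fstar /\ forall x y : R,
    normc (eval2 g (x%:C, y%:C)) <=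
    (1 + normc fstar) * normc (eval2 p (x%:C, y%:C)).
  split=> [|x y]; first by rewrite addr_ge0 ?normc_ge0.
  rewrite eval2Z_sub (le_trans (normcB _ _)) // Normc.normcM mulrDl.
  rewrite mul1r lerD2r.
  exact: half_plane_le_real.
have [rs rsE] := closed_field_poly_normal (lead_poly p M).
(* A non-real root r of lead_poly contributes the superfluous slope Re r, and
   the slope None is listed whether or not it is needed. *)
pose slopes := None :: [seq Some a | a <- map (@complex.Re R) rs].
exists (size slopes), (fun l => nth None slopes l) => x zeta0 px x0 fx zeta_ne.
(* Half the distance: f cannot be within [eps] of f^* and closer than [eps] to [zeta0]. *)
pose eps := normc (zeta0 - fstar) / 2.
have eps0 : 0 < eps by rewrite divr_gt0 // normc_gt0 subr_eq0.
(* [B] and [d] depend on [zeta0] through [eps], whereas [slopes] was fixed before the sequence. *)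
have [B [d [B0 d0 est]]] :=
  near_origin_estimate p_nonzero g_dom p_order p_lead g_order eps0 rsE.
exists (fun l => horn (nth None slopes l) B 1); split.
  by move=> l; exists B, 1; rewrite B0 ltr01.
move/cvgrPdist_lt : fx => /(_ eps%:C); rewrite ltcR => /(_ eps0) fx.
(* The bound 1 is the radius of the horns, [d] that of the estimate. *)
move/cvgrPdist_lt : x0 => /(_ (Num.min d 1)).
rewrite lt_min d0 ltr01 => /(_ isT) x0.
near=> n; apply: contrapT => nohorn.
have xn : `|x n| < Num.min d 1.
  by rewrite -[X in X < _]normrN -sub0r; near: n.
have fn : normc (zeta0 - ratfun q p (real_pt (x n))) < eps.
  by rewrite -ltcR -normr_normc; near: n.
move: xn; rewrite lt_min => /andP[xnd xn1].
have nohorn_slope s : s \in slopes -> ~ horn s B 1 (x n).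
  move=> ss hs; apply: nohorn.
  have lt : (index s slopes < size slopes)%N by rewrite index_mem.
  by exists (Ordinal lt) => //=; rewrite nth_index.
have [x1 x2] : `|(x n).1| <= d /\ `|(x n).2| <= d.
  by move: xnd; rewrite prod_normE gt_max => /andP[/ltW ? /ltW ?].
have gp : normc (eval2 g (real_pt (x n))) <=
    eps * normc (eval2 p (real_pt (x n))).
  apply: est => //.
  (* [x n] is not the origin, since [p] vanishes there but not at [x n]. *)
  - rewrite -negb_and; apply: contra_neqN (px n) => /andP[/eqP y1 /eqP y2].
    by rewrite /real_pt y1 y2.
  - rewrite ltNge; apply/negP => h; exact: (nohorn_slope None (mem_head _ _)).
  - move=> a ars; rewrite ltNge; apply/negP => h.
    apply: (nohorn_slope (Some a)) => //.
    by rewrite in_cons map_f.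
have : normc (ratfun q p (real_pt (x n)) - fstar) <= eps.
  rewrite ratfun_sub // Normc.normcM Normc.normcV ler_pdivrMr ?normc_gt0 //.
have := normcD (zeta0 - ratfun q p (real_pt (x n)))
  (ratfun q p (real_pt (x n)) - fstar).
rewrite subrKA; rewrite /eps in fn *; lra.
Unshelve. all: by end_near. Qed.
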